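(* Let $\gamma\in(0,4)$ and let $\kappa>\max\{4/\gamma-1,\ \gamma/(4-\gamma)\}$. Consider the problem of minimizing over $x=(x_{(1)},x_{(2)})\in\mathbb{R}^2$ the quadratic $$q(x)=\frac{\kappa}{2}x_{(1)}^2+\frac12 x_{(2)}^2,$$ whose minimal value is $q^\star=0$. Suppose the initial point $x^0=(x^0_{(1)},x^0_{(2)})\neq 0$ satisfies $$(x^0_{(2)})^2=\frac{4\kappa^2-\gamma\kappa(\kappa+1)}{\gamma(\kappa+1)-4}\,(x^0_{(1)})^2 .$$ Then the sequence $\{x^k\}$ generated by $\gamma$-PolyakGD applied to $q$ from $x^0$ satisfies, for all $k\ge 0$, $$\left|\frac{x^{k+1}_{(1)}}{x^k_{(1)}}\right|=\left|\frac{x^{k+1}_{(2)}}{x^k_{(2)}}\right|=\frac{\kappa-1}{\kappa+1}\qquad\text{and}\qquad q(x^k)-q^\star=\Big(\frac{\kappa-1}{\kappa+1}\Big)^{2k}\big(q(x^0)-q^\star\big).$$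
   Context: For a differentiable convex function $f$ with minimal value $f^\star$ and a parameter $\gamma>0$, $\gamma$-PolyakGD is the iteration $x^{k+1}=x^k-\gamma\,\alpha_k\nabla f(x^k)$ with Polyak stepsize $\alpha_k=\dfrac{f(x^k)-f^\star}{\|\nabla f(x^k)\|^2}$, $k=0,1,\dots$ ($\|\cdot\|$ is the Euclidean norm; if $\nabla f(x^k)=0$ the iteration stays at $x^k$). Subscripts in parentheses denote coordinates. *)

(* Defs.v *)
From HB Require Import structures.
From mathcomp Require Import all_boot all_order all_algebra.
From mathcomp Require Import all_classical all_reals all_analysis.

Set Implicit Arguments.
Unset Strict Implicit.
Unset Printing Implicit Defensive.

Import Order.TTheory GRing.Theory Num.Theory.
Import numFieldNormedType.Exports.
Local Open Scope classical_set_scope.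
Local Open Scope ring_scope.

(* The library norm `|x| on 'rV[R]_n is the sup norm, hence this definition. *)
Definition enorm (R : realType) (n : nat) (x : 'rV[R]_n) : R :=
  Num.sqrt (\sum_(i < n) x 0 i ^+ 2).

(* 'D_v f x is total: this is the gradient of f only where f is
   differentiable. *)
Definition gradient (R : realType) (n : nat) (f : 'rV[R]_n -> R)
    (x : 'rV[R]_n) : 'rV[R]_n :=
  \row_(i < n) 'D_(delta_mx 0 i) f x.

Definition is_min_value (R : realType) (T : Type) (f : T -> R) (m : R) : Prop :=
  range f m /\ lbound (range f) m.

Definition polyak_stepsize (R : realType) (n : nat) (f : 'rV[R]_n -> R)
    (fstar : R) (x : 'rV[R]_n) : R :=
  (f x - fstar) / enorm (gradient f x) ^+ 2.

Definition polyakGD_step (R : realType) (n : nat) (gamma : R)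
    (f : 'rV[R]_n -> R) (fstar : R) (x : 'rV[R]_n) : 'rV[R]_n :=
  if gradient f x == 0 then x
  else x - (gamma * polyak_stepsize f fstar x) *: gradient f x.

(* fstar is meant to be the minimal value of f, see is_min_value. *)
Definition polyakGD (R : realType) (n : nat) (gamma : R)
    (f : 'rV[R]_n -> R) (fstar : R) (x0 : 'rV[R]_n) (k : nat) : 'rV[R]_n :=
  iter k (polyakGD_step gamma f fstar) x0.

(* Coordinates (1) and (2) are the indices 0 and 1 of 'I_2. *)
Definition quad (R : realType) (kappa : R) (x : 'rV[R]_2) : R :=
  kappa / 2 * x 0 0 ^+ 2 + 1 / 2 * x 0 1 ^+ 2.

(* Main.v *)
Require Import Defs.
From HB Require Import structures.
From mathcomp Require Import all_boot all_order all_algebra.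
From mathcomp Require Import all_classical all_reals all_analysis.
From mathcomp Require Import ring lra.

Set Implicit Arguments.
Unset Strict Implicit.
Unset Printing Implicit Defensive.

Import Order.TTheory GRing.Theory Num.Theory.
Import numFieldNormedType.Exports.
Local Open Scope ring_scope.

(* The scaled Polyak stepsize gamma * alpha equals 2 / (kappa + 1) exactly on a
   quadratic cone, and there a step multiplies the first coordinate by - rho and
   the second one by rho, where rho = (kappa - 1) / (kappa + 1). Such a map
   preserves every cone x_2^2 = c x_1^2, so the stepsize never changes and each
   step multiplies q by rho^2. *)

Lemma eq_in_iter (T : Type) (S : {pred T}) (f g : T -> T) (n : nat) :
  {in S, f =1 g} -> {homo g : x / x \in S} -> {in S, iter n f =1 iter n g}.
Proof.
move=> fg gS x xS; elim: n => [//|n IHn].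
by rewrite !iterS IHn fg //; exact: iter_in.
Qed.

Lemma ord2_ind (P : 'I_2 -> Prop) : P 0 -> P 1 -> forall i, P i.
Proof.
move=> P0 P1 i; have /orP[/eqP->|/eqP->] // : (i == 0) || (i == 1).
by case: i => -[|[]].
Qed.

Lemma rV2_eq0 (V : nmodType) (x : 'rV[V]_2) :
  (x == 0) = (x 0 0 == 0) && (x 0 1 == 0).
Proof.
apply/eqP/andP => [->|[/eqP x00 /eqP x01]]; first by rewrite !mxE.
by apply/rowP; elim/ord2_ind; rewrite mxE.
Qed.

Lemma is_derive_coord (R : realFieldType) (m n : nat) (i : 'I_m) (j : 'I_n)
    (x v : 'M[R]_(m, n)) :
  is_derive x v (fun y : 'M[R]_(m, n) => y i j) (v i j).
Proof.
apply: DeriveDef; first exact/diff_derivable/differentiable_coord.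
have /matrixP/(_ i j) : 'D_v (@idfun 'M[R]_(m, n)) x = v by exact: derive_id.
by rewrite derive_mx ?mxE //; exact: derivable_id.
Qed.

Section EuclideanNorm.
Variables (R : realType) (n : nat).
Implicit Type x : 'rV[R]_n.

Lemma sqr_enorm x : enorm x ^+ 2 = \sum_(i < n) x 0 i ^+ 2.
Proof. by rewrite sqr_sqrtr // sumr_ge0 // => i _; exact: sqr_ge0. Qed.

Lemma enorm_eq0 x : (enorm x == 0) = (x == 0).
Proof.
rewrite -sqrf_eq0 sqr_enorm; apply/eqP/eqP => [x_norm0|->]; last first.
  by rewrite big1 // => i _; rewrite mxE expr0n.
apply/rowP => i; rewrite mxE; apply/eqP; rewrite -sqrf_eq0; apply/eqP.
by apply: psumr_eq0P x_norm0 i isT => j _; exact: sqr_ge0.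
Qed.

End EuclideanNorm.

Section AnisotropicQuadratic.
Variables (R : realType) (kappa : R).
Implicit Types x v : 'rV[R]_2.

Lemma is_min_value_quad : 0 <= kappa -> is_min_value (quad kappa) 0.
Proof.
move=> kappa_ge0; split; first by exists 0 => //; rewrite /quad !mxE; ring.
move=> _ [x _ <-].
by rewrite addr_ge0 // mulr_ge0 ?sqr_ge0 // divr_ge0.
Qed.

#[local] Instance is_derive_quad x v :
  is_derive x v (quad kappa) (kappa * x 0 0 * v 0 0 + x 0 1 * v 0 1).
Proof.
have d0 := is_derive_coord 0 0 x v; have d1 := is_derive_coord 0 1 x v.
apply: is_derive_eq (is_deriveD (is_deriveZ (kappa / 2) (is_deriveX 2 d0))
                                (is_deriveZ (1 / 2) (is_deriveX 2 d1))) _.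
by rewrite /GRing.scale /=; field.
Qed.

Lemma gradient_quad x :
  gradient (quad kappa) x = \row_i ((if i == 0 then kappa else 1) * x 0 i).
Proof.
apply/rowP; elim/ord2_ind; rewrite !mxE derive_val.
  by rewrite !mxE /= mulr1 mulr0 addr0.
by rewrite !mxE /= mulr1 mulr0 add0r mul1r.
Qed.

Lemma gradient_quad_eq0 x :
  kappa != 0 -> (gradient (quad kappa) x == 0) = (x == 0).
Proof.
move=> kappa_neq0; rewrite gradient_quad !rV2_eq0 !mxE /= mul1r.
by rewrite mulf_eq0 (negPf kappa_neq0).
Qed.

Lemma sqr_enorm_gradient_quad x :
  enorm (gradient (quad kappa) x) ^+ 2 =
    kappa ^+ 2 * x 0 0 ^+ 2 + x 0 1 ^+ 2.
Proof.
rewrite sqr_enorm gradient_quad big_ord_recl big_ord1 !mxE /= exprMn mul1r.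
by congr (_ + x 0 _ ^+ 2); exact: val_inj.
Qed.

End AnisotropicQuadratic.

Section DampedReflection.
Variable R : realType.
Implicit Types (r : R) (x : 'rV[R]_2).

Definition damped_reflection r x : 'rV[R]_2 :=
  \row_i ((-1) ^+ (i == 0) * r * x 0 i).

Lemma normr_damped_reflection_ratio r x i :
  x 0 i != 0 -> `|damped_reflection r x 0 i / x 0 i| = `|r|.
Proof. by move=> xi_neq0; rewrite mxE mulfK // normrM normr_sign mul1r. Qed.

Lemma iter_damped_reflection_neq0 r x i k :
  r != 0 -> x 0 i != 0 -> iter k (damped_reflection r) x 0 i != 0.
Proof.
move=> r_neq0 xi_neq0; elim: k => [//|k IHk].
by rewrite iterS mxE !mulf_neq0 // signr_eq0.
Qed.

Lemma sqr_damped_reflection r x i :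
  damped_reflection r x 0 i ^+ 2 = r ^+ 2 * x 0 i ^+ 2.
Proof. by rewrite mxE !exprMn sqrr_sign mul1r. Qed.

Lemma quad_damped_reflection kappa r x :
  quad kappa (damped_reflection r x) = r ^+ 2 * quad kappa x.
Proof. by rewrite /quad !sqr_damped_reflection; ring. Qed.

Lemma quad_iter_damped_reflection kappa r x k :
  quad kappa (iter k (damped_reflection r) x) = r ^+ (2 * k) * quad kappa x.
Proof.
elim: k => [|k IHk]; first by rewrite expr0 mul1r.
by rewrite iterS quad_damped_reflection IHk mulrA -exprD mulnS.
Qed.

End DampedReflection.

Definition contraction_ratio (R : realType) (kappa : R) : R :=
  (kappa - 1) / (kappa + 1).

Section PolyakCone.
Variables (R : realType) (gamma kappa : R).
Implicit Type x : 'rV[R]_2.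

Definition slope_num : R := 4 * kappa ^+ 2 - gamma * kappa * (kappa + 1).

Definition slope_den : R := gamma * (kappa + 1) - 4.

Definition polyak_cone : {pred 'rV[R]_2} :=
  [pred x : 'rV[R]_2 | slope_den * x 0 1 ^+ 2 == slope_num * x 0 0 ^+ 2].

Lemma polyak_cone_slope x :
  slope_den != 0 ->
  (x \in polyak_cone) = (x 0 1 ^+ 2 == slope_num / slope_den * x 0 0 ^+ 2).
Proof.
move=> den_neq0; rewrite inE mulrAC [_ * x 0 1 ^+ 2]mulrC.
by rewrite -[in RHS](inj_eq (mulIf den_neq0)) divfK.
Qed.

Lemma slope_num_gt0 :
  gamma < 4 -> 0 < kappa -> (0 < slope_num) = (gamma / (4 - gamma) < kappa).
Proof.
move=> gamma_lt4 kappa_gt0.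
have -> : slope_num = kappa * (kappa * (4 - gamma) - gamma).
  by rewrite /slope_num; ring.
by rewrite pmulr_rgt0 // subr_gt0 ltr_pdivrMr // subr_gt0.
Qed.

Lemma slope_den_gt0 :
  0 < gamma -> (0 < slope_den) = (4 / gamma - 1 < kappa).
Proof. by move=> gamma_gt0; rewrite subr_gt0 ltrBlDr ltr_pdivrMr // mulrC. Qed.

Lemma polyak_cone_coord_neq0 x i :
  slope_num != 0 -> slope_den != 0 -> x \in polyak_cone -> x != 0 ->
  x 0 i != 0.
Proof.
move=> num_neq0 den_neq0 /eqP xC.
have coord_eq0 : (x 0 0 == 0) = (x 0 1 == 0).
  rewrite -[LHS]sqrf_eq0 -[RHS]sqrf_eq0.
  by rewrite -[LHS](mulrI_eq0 _ (lregP num_neq0)) -xC mulf_eq0 (negPf den_neq0).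
by rewrite rV2_eq0; elim/ord2_ind: i; rewrite coord_eq0 andbb.
Qed.

Lemma damped_reflection_cone r :
  {homo damped_reflection r : x / x \in polyak_cone}.
Proof.
by move=> x; rewrite !inE !sqr_damped_reflection !(mulrCA _ (r ^+ 2)) => /eqP->.
Qed.

Hypotheses (kappa_neq0 : kappa != 0) (kappaD1_neq0 : kappa + 1 != 0).

Lemma polyak_stepsize_quad_cone x :
  x != 0 ->
  (gamma * polyak_stepsize (quad kappa) 0 x == 2 / (kappa + 1)) =
    (x \in polyak_cone).
Proof.
move=> x_neq0; rewrite /polyak_stepsize subr0 mulrA eqr_div //.
  rewrite inE sqr_enorm_gradient_quad /quad /slope_num /slope_den.
  by apply/eqP/eqP => ?; lra.
by rewrite sqrf_eq0 enorm_eq0 gradient_quad_eq0.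
Qed.

Lemma polyakGD_step_cone :
  {in polyak_cone, polyakGD_step gamma (quad kappa) 0 =1
                   damped_reflection (contraction_ratio kappa)}.
Proof.
move=> x xC; rewrite /polyakGD_step gradient_quad_eq0 //.
have [->|x_neq0] := eqVneq; first by apply/rowP => i; rewrite !mxE mulr0.
have /eqP-> : gamma * polyak_stepsize (quad kappa) 0 x == 2 / (kappa + 1).
  by rewrite polyak_stepsize_quad_cone.
rewrite gradient_quad /contraction_ratio.
by apply/rowP; elim/ord2_ind; rewrite !mxE /= ?expr0 ?expr1; field.
Qed.

Lemma polyakGD_cone k :
  {in polyak_cone, forall x,
     polyakGD gamma (quad kappa) 0 x k =
       iter k (damped_reflection (contraction_ratio kappa)) x}.
Proof.
apply: eq_in_iter; first exact: polyakGD_step_cone.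
exact: damped_reflection_cone.
Qed.

End PolyakCone.

(* The two thresholds are inverse to each other. *)
Lemma polyak_threshold_ge1 (R : realFieldType) (gamma : R) :
  0 < gamma < 4 -> 1 <= Num.max (4 / gamma - 1) (gamma / (4 - gamma)).
Proof.
case/andP=> gamma_gt0 gamma_lt4; rewrite le_max lerBrDr.
rewrite !ler_pdivlMr ?subr_gt0 // -implyNb; apply/implyP.
by rewrite -ltNge => ?; lra.
Qed.

Theorem theorem3p1 (R : realType) (gamma kappa : R) (x0 : 'rV[R]_2)
    (hgamma : 0 < gamma < 4)
    (hkappa : Num.max (4 / gamma - 1) (gamma / (4 - gamma)) < kappa)
    (hx0 : x0 <> 0)
    (hinit : x0 0 1 ^+ 2 =
       (4 * kappa ^+ 2 - gamma * kappa * (kappa + 1)) /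
         (gamma * (kappa + 1) - 4) * x0 0 0 ^+ 2) :
  let q := quad kappa in
  let qstar : R := 0 in
  let x := polyakGD gamma q qstar x0 in
  is_min_value q qstar /\
  forall k : nat,
    [/\ `|x k.+1 0 0 / x k 0 0| = (kappa - 1) / (kappa + 1),
        `|x k.+1 0 1 / x k 0 1| = (kappa - 1) / (kappa + 1) &
        q (x k) - qstar =
          ((kappa - 1) / (kappa + 1)) ^+ (2 * k) * (q x0 - qstar)].
Proof.
move=> q qstar x.
have kappa_gt1 := le_lt_trans (polyak_threshold_ge1 hgamma) hkappa.
have kappa_gt0 : 0 < kappa by lra.
have kappaD1_gt0 : 0 < kappa + 1 by lra.
split=> [|k]; first exact/is_min_value_quad/ltW.
move: hkappa; rewrite gt_max; case/andP: hgamma => gamma_gt0 gamma_lt4.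
rewrite -slope_den_gt0 // -slope_num_gt0 // => /andP[den_gt0 num_gt0].
have x0C : x0 \in polyak_cone gamma kappa.
  by rewrite polyak_cone_slope ?hinit ?eqxx ?gt_eqF.
set rho := (kappa - 1) / (kappa + 1).
have rho_gt0 : 0 < rho by rewrite divr_gt0 ?subr_gt0.
have xE j : x j = iter j (damped_reflection rho) x0.
  by apply: polyakGD_cone; rewrite ?gt_eqF.
have ratio i : `|x k.+1 0 i / x k 0 i| = rho.
  rewrite !xE iterS normr_damped_reflection_ratio ?gtr0_norm //.
  apply: iter_damped_reflection_neq0; first by rewrite gt_eqF.
  by apply: polyak_cone_coord_neq0 x0C _; rewrite ?gt_eqF //; exact/eqP.
by split; rewrite ?ratio // !subr0 xE; exact: quad_iter_damped_reflection.
Qed.
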